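(* Let $X,Y$ be nonempty sets, let $\Delta=\Delta_{\mathcal R}\colon\mathcal P(\mathcal P(X))^n\to\mathcal P(\mathcal P(Y))$ be a Kripke-operator, let $\mathcal A_0,\ldots,\mathcal A_{n-1}\subseteq\mathcal P(X)$, and let $\mathcal A=\Delta(\mathcal A_0,\ldots,\mathcal A_{n-1})$. (a) If $\Delta$ weakly preserves dominated convexity, then $\mathrm D(\mathcal A)\le\mathrm D(\mathcal A_0)\cdot\ldots\cdot\mathrm D(\mathcal A_{n-1})$. (b) If $\Delta$ weakly preserves supported convexity, then $\mathrm D^d(\mathcal A)\le\mathrm D^d(\mathcal A_0)\cdot\ldots\cdot\mathrm D^d(\mathcal A_{n-1})$. (c) If $\Delta$ weakly preserves intervals, then $\mathrm{CD}(\mathcal A)\le\mathrm{CD}(\mathcal A_0)\cdot\ldots\cdot\mathrm{CD}(\mathcal A_{n-1})$.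
   Context: $[A,B]=\{C:A\subseteq C\subseteq B\}$. A family of sets $\mathcal A$ is an interval if $\mathcal A=[A_0,A_1]$ with $A_0\subseteq A_1$; convex if $[S,T]\subseteq\mathcal A$ for all $S,T\in\mathcal A$; dominated if $\bigcup\mathcal A\in\mathcal A$; supported if it is nonempty and $\bigcap\mathcal A\in\mathcal A$. $\mathcal G\subseteq\mathcal A$ dominates $\mathcal A$ if there are dominated convex families $\mathcal D_G$ ($G\in\mathcal G$) with $\bigcup_{G\in\mathcal G}\mathcal D_G=\mathcal A$ and $\bigcup\mathcal D_G=G$ for each $G$; $\mathcal K\subseteq\mathcal A$ supports $\mathcal A$ if there are supported convex families $\mathcal S_K$ ($K\in\mathcal K$) with $\bigcup_{K\in\mathcal K}\mathcal S_K=\mathcal A$ and $\bigcap\mathcal S_K=K$ for each $K$. $\mathrm D(\mathcal A)$ is the minimal cardinality of a subfamily dominating $\mathcal A$, $\mathrm D^d(\mathcal A)$ the minimal cardinality of a subfamily supporting $\mathcal A$, and $\mathrm{CD}(\mathcal A)$ the least $|I|$ such that $\mathcal A=\bigcup_{i\in I}\mathcal A_i$ for some intervals $\mathcal A_i$. For a relation $\mathcal R\subseteq\mathcal P(Y)\times\mathcal P(X)^n$ ($n$ a positive integer), $\Delta_{\mathcal R}\colon\mathcal P(\mathcal P(X))^n\to\mathcal P(\mathcal P(Y))$ is defined by: $B\in\Delta_{\mathcal R}(\mathcal A_0,\ldots,\mathcal A_{n-1})$ iff there are $A_0\in\mathcal A_0,\ldots,A_{n-1}\in\mathcal A_{n-1}$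 with $(B,A_0,\ldots,A_{n-1})\in\mathcal R$. An operator is a Kripke-operator if it equals $\Delta_{\mathcal R}$ for some such $\mathcal R$. An operator $\Delta$ weakly preserves dominated (respectively supported) convexity if, whenever every $\mathcal A_i$ ($i<n$) is dominated and convex (respectively supported and convex), $\Delta(\mathcal A_0,\ldots,\mathcal A_{n-1})$ is either dominated and convex (respectively supported and convex) or empty. $\Delta$ weakly preserves intervals if, whenever every $\mathcal A_i$ is an interval, $\Delta(\mathcal A_0,\ldots,\mathcal A_{n-1})$ is an interval or empty. *)

(* Defs.v *)
From HB Require Import structures.
From mathcomp Require Import all_boot.
From mathcomp Require Import boolp classical_sets functions cardinality.

Set Implicit Arguments.
Unset Strict Implicit.
Unset Printing Implicit Defensive.

Local Open Scope classical_set_scope.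
Local Open Scope card_scope.

(* Subsets of X are terms of type [set X]; a family of subsets of X is a term
   of type [set (set X)].  The base sets may be infinite, so dimensions are
   cardinals: a cardinal is represented by a set having it, and cardinals are
   compared with [#<=] (existence of an injection). *)

Section Families.
Context {X : Type}.
Implicit Types (A B C S T : set X) (F G K : set (set X)).

Definition itv A B : set (set X) := [set C | A `<=` C /\ C `<=` B].

Definition is_interval F := exists A B, A `<=` B /\ F = itv A B.

Definition convex F := forall S T, F S -> F T -> itv S T `<=` F.

Definition dominated F := F (\bigcup_(A in F) A).

Definition supported F := F !=set0 /\ F (\bigcap_(A in F) A).

Definition dominated_convex F := dominated F /\ convex F.

Definition supported_convex F := supported F /\ convex F.

Definition dominates G F :=
  G `<=` F /\
  exists D : set X -> set (set X),
    [/\ forall A, G A -> dominated_convex (D A),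
        \bigcup_(A in G) D A = F
      & forall A, G A -> \bigcup_(B in D A) B = A].

Definition supports K F :=
  K `<=` F /\
  exists S : set X -> set (set X),
    [/\ forall A, K A -> supported_convex (S A),
        \bigcup_(A in K) S A = F
      & forall A, K A -> \bigcap_(B in S A) B = A].

Definition interval_cover F (J : Type) (I : set J) :=
  exists f : J -> set (set X),
    (forall i, I i -> is_interval (f i)) /\ F = \bigcup_(i in I) f i.

End Families.

(* A member of P of minimal cardinality. *)
Definition least_card {T : Type} (P : set (set T)) : set T :=
  xget set0 [set G | P G /\ forall H, P H -> G #<= H].

(* Cardinals are well-ordered: a maximal set F of choice functions on P, any
   two of which differ at every argument, projects onto some member of P. *)
Lemma least_cardP {T : Type} (P : set (set T)) : P !=set0 ->
  P (least_card P) /\ forall H, P H -> least_card P #<= H.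
Proof.
move=> [G0 PG0]; rewrite /least_card.
set Q := [set G | _ /\ _]; suff: exists G, Q G by move=> /(xgetPex set0).
have [[t0 _]|noT] := pselect (exists x : T, True); last first.
  exists G0; split=> // H _; apply: subset_card_le => x.
  by case: noT; exists x.
pose W (F : set (set T -> T)) :=
  (forall h, F h -> forall G, P G -> G (h G)) /\
  (forall h k G, F h -> F k -> P G -> h G = k G -> h = k).
have [|F [[Fin Finj] Fmax]] := @Zorn_bigcup _ W.
  move=> C CW Ctot; split=> [h [F CF Fh]|h k G [F CF Fh] [F' CF' Fk]].
    by apply: (CW _ CF).1.
  have [sub|sub] := Ctot _ _ CF CF'.
    by apply: (CW _ CF').2 => //; apply: sub.
  by apply: (CW _ CF).2 => //; apply: sub.
have [G [PG Gsurj]] : exists G, P G /\ forall x, G x -> exists2 h, F h & h G = x.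
  apply: contrapT => noG.
  have miss G : exists x, P G -> G x /\ forall h, F h -> h G <> x.
    have [PG|nPG] := pselect (P G); last by exists t0.
    apply: contrapT => nox; apply: noG; exists G; split=> // x Gx.
    apply: contrapT => noh; apply: nox; exists x => _; split=> // h Fh hG.
    by apply: noh; exists h.
  have [h0 h0P] := choice miss.
  apply: (Fmax (F `|` [set h0])); first last.
    split=> [h [Fh|->] G PG|h k G [Fh|->] [Fk|->] PG //]; first exact: (Fin h Fh G PG).
    - by have [] := h0P _ PG.
    - exact: (Finj h k G).
    - by move=> hk; have [_ /(_ _ Fh) /(_ hk)] := h0P _ PG.
    - by move=> hk; have [_ /(_ _ Fk)] := h0P _ PG; rewrite hk.
  split=> [|/(_ h0 (or_intror erefl)) Fh0]; first by move=> h; left.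
  by have [_ /(_ _ Fh0)] := h0P _ PG0.
exists G; split=> // H PH.
have step (x : T) : exists y, G x -> exists h, [/\ F h, h G = x & y = h H].
  have [Gx|nGx] := pselect (G x); last by exists x.
  by have [h Fh hx] := Gsurj x Gx; exists (h H) => _; exists h.
have [g gP] := choice step.
apply: (@card_le_trans _ _ _ (g @` G)); last first.
  by apply: subset_card_le => _ [x /gP[h [Fh _ ->]] <-]; exact: (Fin h Fh H PH).
have ginj : {in G &, injective g}.
  move=> x y /set_mem/gP[h [Fh <- ->]] /set_mem/gP[k [Fk <- ->]] /Finj-/(_ Fh Fk PH).
  by move->.
by have := inj_card_eq ginj; rewrite card_eq_le => /andP[].
Qed.

Section Dimensions.
Context {X : Type}.
Implicit Types F : set (set X).

Definition upper_dim F : set (set X) := least_card [set G | dominates G F].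

Definition dual_upper_dim F : set (set X) := least_card [set K | supports K F].

(* The index sets range over the sets of families; by [cyl_dim_le], arbitrary
   index sets do not give a smaller cardinal. *)
Definition cyl_dim F : set (set (set X)) :=
  least_card [set I | interval_cover F I].

Lemma itvxx (A : set X) : itv A A = [set A].
Proof.
by apply/seteqP; split=> [B [AB BA]|B ->]; [apply/seteqP|split].
Qed.

Lemma singleton_convex (A : set X) : convex [set A].
Proof. by move=> S T -> ->; rewrite itvxx. Qed.

Lemma upper_dimP F : dominates (upper_dim F) F /\
  forall G, dominates G F -> upper_dim F #<= G.
Proof.
apply: (@least_cardP _ [set G | dominates G F]); exists F; split=> //.
exists set1; split=> [A _||A _]; last by rewrite bigcup_set1.
  by split; [rewrite /dominated bigcup_set1|exact: singleton_convex].
by apply/seteqP; split=> [B [A FA ->]|A FA] //; exists A.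
Qed.

Lemma dual_upper_dimP F : supports (dual_upper_dim F) F /\
  forall K, supports K F -> dual_upper_dim F #<= K.
Proof.
apply: (@least_cardP _ [set K | supports K F]); exists F; split=> //.
exists set1; split=> [A _||A _]; last by rewrite bigcap_set1.
  split; last exact: singleton_convex.
  by split; [exists A|rewrite bigcap_set1].
by apply/seteqP; split=> [B [A FA ->]|A FA] //; exists A.
Qed.

Lemma cyl_dimP F : interval_cover F (cyl_dim F) /\
  forall I : set (set (set X)), interval_cover F I -> cyl_dim F #<= I.
Proof.
apply: (@least_cardP _ [set I | interval_cover F I]).
exists (set1 @` F); exists id; split=> [_ [A _ <-]|].
  by exists A, A; split; rewrite ?itvxx.
apply/seteqP; split=> [A FA|B [_ [A FA <-] ->]] //.
by exists [set A] => //; exists A.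
Qed.

Lemma cyl_dim_le F (J : Type) (I : set J) :
  interval_cover F I -> cyl_dim F #<= I.
Proof.
move=> [f [fI ->]]; apply: card_le_trans (card_image_le f I).
apply: (cyl_dimP _).2; exists id; split; first by move=> _ [i Ii <-]; exact: fI.
by rewrite bigcup_image.
Qed.

End Dimensions.

(* The product of the cardinals of the sets [G i]. *)
Definition tuple_prod {T : Type} {n : nat} (G : 'I_n -> set T) :
  set ('I_n -> T) := [set g | forall i, G i (g i)].

Section Operators.
Context {X Y : Type} {n : nat}.

(* n-tuples are functions on ['I_n]. *)
Definition kripke (R : set (set Y * ('I_n -> set X)))
    (F : 'I_n -> set (set X)) : set (set Y) :=
  [set B | exists A : 'I_n -> set X, (forall i, F i (A i)) /\ R (B, A)].

Definition kripke_operator (Delta : ('I_n -> set (set X)) -> set (set Y)) :=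
  exists R, Delta = kripke R.

Definition weakly_preserves (P : forall Z : Type, set (set Z) -> Prop)
    (Delta : ('I_n -> set (set X)) -> set (set Y)) :=
  forall F : 'I_n -> set (set X),
    (forall i, P X (F i)) -> P Y (Delta F) \/ Delta F = set0.

End Operators.

(* Main.v *)
Require Import Defs.
From mathcomp Require Import all_boot.
From mathcomp Require Import boolp classical_sets functions cardinality.

Local Open Scope classical_set_scope.
Local Open Scope card_scope.

(** A Kripke-operator distributes over unions in each argument
    ([kripke_bigcup]). So if each [F i] is the union of pieces [D i k], [k] in
    [G i], then [Delta F] is the union of the families
    [Delta (fun i => D i (g i))], where [g] runs over the product of the
    [G i]. When the pieces are of a kind that [Delta] weakly preserves, each of
    these families is of that kind or empty, and the empty ones may be dropped
    ([weakly_preserves_cover]).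

    It remains to see that a cover of a family by pieces of the given kind,
    indexed by [I], bounds its dimension by the cardinal of [I]. For intervals
    this is [cyl_dim_le]. For dominated convex families ([upper_dim_le]) it
    needs an argument, because a dominating subfamily carries only one piece
    for each top element, while several members of the cover may have the same
    union. These can be merged: a union of dominated convex families with a
    common top element [A] is convex, since [S] in one of them forces the whole
    interval from [S] to [A] into that same one. The supported case
    ([dual_upper_dim_le]) is order-dual. *)

Section CoverBounds.
Context {X J : Type}.
Implicit Types (I : set J) (E : J -> set (set X)) (F : set (set X)).

(** The dominating subfamily consists of the unions of the [E i]. *)
Lemma upper_dim_le F I E :
  (forall i, I i -> dominated_convex (E i)) -> F = \bigcup_(i in I) E i ->
  upper_dim F #<= I.
Proof.
move=> EI ->; pose top i := \bigcup_(B in E i) B.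
have Etop i : I i -> E i (top i) by move=> /EI[].
have le_top i B : E i B -> B `<=` top i by move=> EB x Bx; exists B.
(* The pieces with the same top are merged. *)
pose D A := \bigcup_(i in [set i | I i /\ top i = A]) E i.
have Dtop A : (top @` I) A -> D A A.
  by move=> [i Ii <-]; exists i => //; exact: Etop.
have DU A : (top @` I) A -> \bigcup_(B in D A) B = A.
  move=> IA; apply/seteqP; split=> [x [B [i [_ <-] EB] Bx]|x Ax].
    exact: (le_top i B EB).
  by exists A => //; exact: Dtop.
apply: card_le_trans (card_image_le top I).
apply: (upper_dimP _).2; split=> [_ [i Ii <-]|].
  by exists i => //; exact: Etop.
exists D; split=> // [A IA|].
- split; first by rewrite /dominated DU //; exact: Dtop.
  move=> S T [i [Ii topi] ES] [j [_ topj] ET] C [SC CT].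
  exists i => //; apply: ((EI i Ii).2 _ _ ES (Etop i Ii)); split=> //.
  by rewrite topi -topj; exact: subset_trans CT (le_top j T ET).
- apply/seteqP; split=> [B [_ _ [i [Ii _] EB]]|B [i Ii EB]].
    by exists i.
  by exists (top i); [exists i|exists i].
Qed.

(** The supporting subfamily consists of the intersections of the [E i]. *)
Lemma dual_upper_dim_le F I E :
  (forall i, I i -> supported_convex (E i)) -> F = \bigcup_(i in I) E i ->
  dual_upper_dim F #<= I.
Proof.
move=> EI ->; pose bot i := \bigcap_(B in E i) B.
have Ebot i : I i -> E i (bot i) by move=> /EI[[]].
have bot_le i B : E i B -> bot i `<=` B by move=> EB x; exact.
(* The pieces with the same bottom are merged. *)
pose D A := \bigcup_(i in [set i | I i /\ bot i = A]) E i.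
have Dbot A : (bot @` I) A -> D A A.
  by move=> [i Ii <-]; exists i => //; exact: Ebot.
have DI A : (bot @` I) A -> \bigcap_(B in D A) B = A.
  move=> IA; apply/seteqP; split=> [x|x Ax B [i [_ botA] EB]].
    by apply; exact: Dbot.
  by apply: (bot_le i B EB); rewrite botA.
apply: card_le_trans (card_image_le bot I).
apply: (dual_upper_dimP _).2; split=> [_ [i Ii <-]|].
  by exists i => //; exact: Ebot.
exists D; split=> // [A IA|].
- split; first by split; [exists A; exact: Dbot|rewrite DI //; exact: Dbot].
  move=> S T [j [_ botj] ES] [i [Ii boti] ET] C [SC CT].
  exists i => //; apply: ((EI i Ii).2 _ _ (Ebot i Ii) ET); split=> //.
  by rewrite boti -botj; exact: subset_trans (bot_le j S ES) SC.
- apply/seteqP; split=> [B [_ _ [i [Ii _] EB]]|B [i Ii EB]].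
    by exists i.
  by exists (bot i); [exists i|exists i].
Qed.

End CoverBounds.

Section KripkeCovers.
Context {X Y K : Type} {n : nat}.

Lemma kripke_bigcup (R : set (set Y * ('I_n -> set X))) (G : 'I_n -> set K)
    (D : 'I_n -> K -> set (set X)) :
  kripke R (fun i => \bigcup_(k in G i) D i k) =
  \bigcup_(g in tuple_prod G) kripke R (fun i => D i (g i)).
Proof.
apply/seteqP; split=> [B [A [DA RBA]]|B [g Gg [A [DA RBA]]]].
  have pick i : exists k, G i k /\ D i k (A i).
    by have [k Gk Dk] := DA i; exists k.
  have [g gP] := choice pick.
  exists g => [i|]; first exact: (gP i).1.
  by exists A; split=> // i; exact: (gP i).2.
by exists A; split=> // i; exists (g i).
Qed.

Lemma weakly_preserves_cover (P : forall Z : Type, set (set Z) -> Prop)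
    (Delta : ('I_n -> set (set X)) -> set (set Y)) (F : 'I_n -> set (set X))
    (G : 'I_n -> set K) (D : 'I_n -> K -> set (set X)) :
  kripke_operator Delta -> weakly_preserves P Delta ->
  (forall i, F i = \bigcup_(k in G i) D i k) ->
  (forall i k, G i k -> P X (D i k)) ->
  exists I, [/\ I `<=` tuple_prod G,
    forall g, I g -> P Y (Delta (fun i => D i (g i)))
    & Delta F = \bigcup_(g in I) Delta (fun i => D i (g i))].
Proof.
move=> [R ->] PR FD PD.
have -> : F = (fun i => \bigcup_(k in G i) D i k) by apply/funext.
pose E (g : 'I_n -> K) := kripke R (fun i => D i (g i)).
exists [set g | tuple_prod G g /\ E g !=set0]; split=> [g []//|g [Gg [B EB]]|].
  have [//|E0] := PR _ (fun i => PD i _ (Gg i)).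
  by move: EB; rewrite /E E0.
rewrite kripke_bigcup; apply/seteqP; split=> [B [g Gg EB]|B [g [Gg _] EB]].
  by exists g => //; split=> //; exists B.
by exists g.
Qed.

End KripkeCovers.

Theorem theorem4p12 (X Y : Type) (n : nat)
  (hX : [set: X] !=set0) (hY : [set: Y] !=set0) (hn : (0 < n)%N)
  (Delta : ('I_n -> set (set X)) -> set (set Y))
  (hDelta : kripke_operator Delta)
  (F : 'I_n -> set (set X)) :
  [/\ weakly_preserves (@dominated_convex) Delta ->
        upper_dim (Delta F) #<= tuple_prod (fun i => upper_dim (F i)),
      weakly_preserves (@supported_convex) Delta ->
        dual_upper_dim (Delta F) #<= tuple_prod (fun i => dual_upper_dim (F i))
    & weakly_preserves (@is_interval) Delta ->
        cyl_dim (Delta F) #<= tuple_prod (fun i => cyl_dim (F i))].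
Proof.
split=> wp.
- have [D DP] := choice (fun i => (upper_dimP (F i)).1.2).
  have [||I [IG IP FE]] := weakly_preserves_cover _ Delta F
    (fun i => upper_dim (F i)) D hDelta wp.
  + by move=> i; have [_ ->] := DP i.
  + by move=> i; have [] := DP i.
  exact: card_le_trans (upper_dim_le _ _ _ IP FE) (subset_card_le IG).
- have [D DP] := choice (fun i => (dual_upper_dimP (F i)).1.2).
  have [||I [IG IP FE]] := weakly_preserves_cover _ Delta F
    (fun i => dual_upper_dim (F i)) D hDelta wp.
  + by move=> i; have [_ ->] := DP i.
  + by move=> i; have [] := DP i.
  exact: card_le_trans (dual_upper_dim_le _ _ _ IP FE) (subset_card_le IG).
- have [D DP] := choice (fun i => (cyl_dimP (F i)).1).
  have [||I [IG IP FE]] := weakly_preserves_cover _ Delta F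
    (fun i => cyl_dim (F i)) D hDelta wp.
  + by move=> i; exact: (DP i).2.
  + by move=> i; exact: (DP i).1.
  apply: card_le_trans (subset_card_le IG).
  by apply: cyl_dim_le; exists (fun g => Delta (fun i => D i (g i))).
Qed.
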